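(* Let $(X,d)$ be a compact metric space and let $m\ge 2$. Let $f:X\to X$ be a continuous map and let $A=(a_{ij})$ be an irreducible $m\times m$ transition matrix such that there exists an index $i_0$ with $\sum_{j=1}^m a_{i_0 j}\ge 2$. Let $V_1,\dots,V_m$ be compact subsets of $X$ such that $f$ is strictly $A$-coupled-expanding in $V_i$ ($1\le i\le m$). If there exists a periodic point $\alpha=(a_0a_1\ldots)\in\Sigma_A$ (that is, $\sigma_A^T(\alpha)=\alpha$ for some integer $T\ge 1$) such that $$V_\alpha=\bigcap_{n=0}^\infty f^{-n}(V_{a_n})$$ is a singleton, then $f$ is distributionally chaotic of type 1.
   Context: Transition matrix: an $m\times m$ matrix $A=(a_{ij})$ is a transition matrix if $a_{ij}\in\{0,1\}$ for all $i,j$, $\sum_{j=1}^m a_{ij}\ge 1$ for every $i$, and $\sum_{i=1}^m a_{ij}\ge 1$ for every $j$. It is irreducible if for every pair $1\le i,j\le m$ there is an integer $k\ge 1$ such that the $(i,j)$ entry of $A^k$ is positive. Symbol space: $\mathbb{N}_0=\{0,1,2,\dots\}$ and $\Sigma_A=\{(b_0b_1\ldots) : b_i\in\{1,\dots,m\},\ a_{b_ib_{i+1}}=1 \text{ for all } i\in\mathbb{N}_0\}$, the set of one-sided infinite sequences admissible for $A$. The map $\sigma_A:\Sigma_A\to\Sigma_A$ is the shift $\sigma_A(b_0b_1b_2\ldots)=(b_1b_2\ldots)$. $f^0$ is the identity map. Strictly $A$-coupled-expanding: $f$ is $A$-coupled-expanding in $V_1,\dots,V_m$ if the $V_i$ are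 nonempty subsets with pairwise disjoint interiors and $f(V_i)\supset\bigcup_{j:\,a_{ij}=1}V_j$ for all $1\le i\le m$. It is strictly $A$-coupled-expanding in $V_1,\dots,V_m$ if moreover $d(V_i,V_j)=\inf\{d(x,y):x\in V_i,y\in V_j\}>0$ for all $1\le i\ne j\le m$. Distributional chaos of type 1: for $x,y\in X$, $t>0$ and $n\ge1$ set $$F^{(n)}_{xy}(t)=\frac1n\#\{i: d(f^i(x),f^i(y))<t,\ 0\le i<n\},$$ $F_{xy}(t)=\liminf_{n\to\infty}F^{(n)}_{xy}(t)$ and $F^*_{xy}(t)=\limsup_{n\to\infty}F^{(n)}_{xy}(t)$. A pair $(x,y)$ is a distributionally chaotic pair of type 1 if $F^*_{xy}(t)=1$ for all $t>0$ and there exists $s>0$ with $F_{xy}(s)=0$. A subset of $X$ containing at least two points is a distributional scrambled set of type 1 if any two distinct points of it form a distributionally chaotic pair of type 1. The map $f$ is distributionally chaotic of type 1 if it has an uncountable distributional scrambled set of type 1. *)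

(* Defs.v *)
From HB Require Import structures.
From mathcomp Require Import all_boot all_order all_algebra.
From mathcomp Require Import all_classical all_reals all_analysis.

Set Implicit Arguments.
Unset Strict Implicit.
Unset Printing Implicit Defensive.

Import Order.TTheory GRing.Theory Num.Theory.
Import numFieldNormedType.Exports.

Local Open Scope classical_set_scope.
Local Open Scope ring_scope.

(* Matrices have entries in the semiring nat; indices and symbols 1, ..., m are
   represented by 'I_m = {0, ..., m - 1}. *)
Definition transition_matrix (m : nat) (A : 'M[nat]_m) : Prop :=
  [/\ forall i j, A i j = 0%N \/ A i j = 1%N,
      forall i, (1 <= \sum_(j < m) A i j)%N &
      forall j, (1 <= \sum_(i < m) A i j)%N].

Definition irreducible_matrix (m : nat) (A : 'M[nat]_m) : Prop :=
  forall i j, exists2 k : nat, (1 <= k)%N & (0 < (A ^+ k) i j)%N.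

Definition symbol_space (m : nat) (A : 'M[nat]_m) : set (nat -> 'I_m) :=
  [set b | forall i, A (b i) (b i.+1) = 1%N].

(* The shift is defined on all sequences; it maps symbol_space A to itself. *)
Definition seq_shift (S : Type) (b : nat -> S) : nat -> S := fun n => b n.+1.

Definition coupled_expanding (R : realType) (X : metricType R) (m : nat)
    (A : 'M[nat]_m) (V : 'I_m -> set X) (f : X -> X) : Prop :=
  [/\ forall i, V i !=set0,
      forall i j, i != j -> interior (V i) `&` interior (V j) = set0 &
      forall i, \bigcup_(j in [set j | A i j = 1%N]) V j `<=` f @` V i].

(* On an empty family inf is 0; this is never reached below, where both sets
   are nonempty. *)
Definition set_dist (R : realType) (X : metricType R) (U W : set X) : R :=
  inf [set r : R | exists2 x, U x & exists2 y, W y & r = mdist x y].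

Definition strictly_coupled_expanding (R : realType) (X : metricType R)
    (m : nat) (A : 'M[nat]_m) (V : 'I_m -> set X) (f : X -> X) : Prop :=
  coupled_expanding A V f /\
  forall i j, i != j -> 0 < set_dist (V i) (V j).

Definition itinerary_set (X : Type) (m : nat) (f : X -> X)
    (V : 'I_m -> set X) (a : nat -> 'I_m) : set X :=
  \bigcap_(n in [set: nat]) ((fun x => iter n f x) @^-1` V (a n)).

(* The value at n = 0 is 0 and does not affect the limits in n. *)
Definition dist_fun (R : realType) (X : metricType R) (f : X -> X)
    (x y : X) (n : nat) (t : R) : R :=
  #|[pred i : 'I_n | mdist (iter i f x) (iter i f y) < t]|%:R / n%:R.

Definition lower_dist_fun (R : realType) (X : metricType R) (f : X -> X)
    (x y : X) (t : R) : R :=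
  limn_inf (fun n => dist_fun f x y n t).

Definition upper_dist_fun (R : realType) (X : metricType R) (f : X -> X)
    (x y : X) (t : R) : R :=
  limn_sup (fun n => dist_fun f x y n t).

Definition dist_chaotic_pair1 (R : realType) (X : metricType R) (f : X -> X)
    (x y : X) : Prop :=
  (forall t : R, 0 < t -> upper_dist_fun f x y t = 1) /\
  (exists2 s : R, 0 < s & lower_dist_fun f x y s = 0).

Definition dist_scrambled_set1 (R : realType) (X : metricType R) (f : X -> X)
    (S : set X) : Prop :=
  (exists x y, [/\ S x, S y & x <> y]) /\
  (forall x y, S x -> S y -> x <> y -> dist_chaotic_pair1 f x y).

Definition dist_chaotic1 (R : realType) (X : metricType R) (f : X -> X)
    : Prop :=
  exists2 S : set X, ~ countable S & dist_scrambled_set1 f S.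

(* Main.v *)
(** By irreducibility and the branching row there are two distinct loops of the
    same length at [alpha 0]; repeating both, one of them differs from a power
    of the period of [alpha]. This gives two words [u] and [v] of a common
    length [L], the first being the beginning of [alpha], that can be
    concatenated freely, and that differ at some position [r].
    Cut [nat] into the windows [k`!, k.+1`!), each of which has asymptotically
    full density in the initial segment where it ends. To a sequence of bits
    indexed by windows corresponds the itinerary made of [u]-blocks or of
    [v]-blocks throughout each window, according to the bit, and by compactness
    some point follows this itinerary. In a window where two points both have
    [u]-blocks they both follow [alpha], hence are close to the orbit of the
    single point of [V_alpha] except near the end; in a window where their bits
    differ, their itineraries differ once in each block, and uniform continuity
    keeps the orbits apart in between. *)
Require Import Defs.
From HB Require Import structures.
From mathcomp Require Import all_boot all_order all_algebra.
From mathcomp Require Import all_classical all_reals all_analysis.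
From mathcomp Require Import zify.

Set Implicit Arguments.
Unset Strict Implicit.
Unset Printing Implicit Defensive.

Import Order.TTheory GRing.Theory Num.Theory.
Import numFieldNormedType.Exports.

Local Open Scope classical_set_scope.
Local Open Scope ring_scope.

(** * Compactness and uniform continuity *)

(** Near-covering compactness along the filter at infinity: each point avoids some closed [K n], and
    so do its neighbours for all later indices. *)
Lemma compact_decreasing_eq0 (T : topologicalType) (K : nat -> set T) :
  compact [set: T] -> (forall n, closed (K n)) ->
  (forall n p, (n <= p)%N -> K p `<=` K n) ->
  \bigcap_n K n = set0 -> exists n, K n = set0.
Proof.
move=> /compact_near_coveringP cT cK decK K0.
have [x _|N _ KN] := cT nat \oo (fun n x => ~ K n x) _.
  have [n nKx] : exists n, ~ K n x.
    apply/not_existsP => Kx; suff : (\bigcap_n K n) x by rewrite K0.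
    by move=> n _; apply: contrapT; exact: Kx.
  exists (~` K n, [set p | (n <= p)%N]) => /=.
    split; last exact: nbhs_infty_ge.
    by apply: open_nbhs_nbhs; split => //; exact/closed_openC.
  by move=> [y p] /= [nKy np] Kpy; apply: nKy; exact: decK Kpy.
exists N; rewrite -subset0 => x Kx.
by apply: (KN N (leqnn N) x).
Qed.

Lemma continuous_iter (T : topologicalType) (f : T -> T) (n : nat) :
  continuous f -> continuous (iter n f).
Proof.
move=> fc; elim: n => [|n IH] x /=; first exact: cvg_id.
by apply: continuous_comp; [exact: IH|exact: fc].
Qed.

Lemma continuous_mdist_near (R : realType) (X : metricType R) (g : X -> X)
    (x : X) (e : R) : continuous g -> 0 < e ->
  \forall y \near x, mdist (g x) (g y) < e.
Proof.
move=> gc e0; have := gc x _ (nbhsx_ballx (g x) e e0).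
by rewrite ballEmdist.
Qed.

(** Stating uniform continuity along the filter [0^'+] lets a single bound serve finitely many maps
    at once. *)
Lemma compact_uniform_mdist (R : realType) (X : metricType R) (g : X -> X)
    (e : R) : compact [set: X] -> continuous g -> 0 < e ->
  \forall d \near 0^'+, forall x y, mdist x y < d -> mdist (g x) (g y) < e.
Proof.
move=> /compact_near_coveringP cX gc e0.
have e20 : 0 < e / 2 by rewrite divr_gt0.
have [x _|d /= d0 dP] := cX R 0^'+
    (fun d x => forall y, mdist x y < d -> mdist (g x) (g y) < e) _.
  have := continuous_mdist_near x gc e20.
  move=> /nbhs_ballP[r /= r0 rP].
  have r20 : 0 < r / 2 by rewrite divr_gt0.
  exists (ball x (r / 2), [set d | d < r / 2]) => /=.
    split; first exact: nbhsx_ballx.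
    exact: nbhs_right_lt.
  move=> [y d] /= [xy dr] z yz.
  rewrite (le_lt_trans (metric_triangle _ (g x) _))// (splitr e) ltrD//.
    rewrite metric_sym; apply: rP; move: xy.
    rewrite !ballEmdist /= => /lt_le_trans; apply.
    by rewrite ler_pdivrMr// ler_peMr ?ler1n// ltW.
  apply: rP; rewrite ballEmdist /= (le_lt_trans (metric_triangle _ y _))//.
  rewrite (splitr r) ltrD//.
    by move: xy; rewrite ballEmdist.
  exact: lt_trans dr.
by exists d => // c /= c0 cd x y; exact: (dP c c0 cd).
Qed.

(** * Points with a prescribed itinerary *)

Section itineraries.
Context (R : realType) (X : metricType R) (m : nat) (f : X -> X)
  (A : 'M[nat]_m) (V : 'I_m -> set X).
Context (cX : compact [set: X]) (fc : continuous f)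
  (cV : forall i, compact (V i)).

Definition finite_itinerary_set (b : nat -> 'I_m) (N : nat) : set X :=
  [set x | forall n, (n <= N)%N -> V (b n) (iter n f x)].

Lemma closed_finite_itinerary_set b N : closed (finite_itinerary_set b N).
Proof.
rewrite (_ : finite_itinerary_set b N =
  \bigcap_(n in [set n | (n <= N)%N]) (iter n f @^-1` V (b n))) //.
apply: closed_bigI => n _; apply: preimage_closed => [x _|].
  exact: continuous_iter.
by apply: compact_closed; [exact: metric_hausdorff|exact: cV].
Qed.

Lemma bigcap_finite_itinerary_set b :
  \bigcap_N finite_itinerary_set b N = itinerary_set f V b.
Proof.
apply/seteqP; split=> x xb n _; first exact: (xb n).
by move=> p _; exact: xb.
Qed.

(** Induction on [N] for all sequences at once: a point following the shifted sequence lies in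
    [V (b 1)], hence has a preimage in [V (b 0)]. *)
Lemma finite_itinerary_set_neq0 b N : coupled_expanding A V f ->
  symbol_space A b -> finite_itinerary_set b N !=set0.
Proof.
move=> [V0 _ fV]; elim: N b => [|N IH] b bA.
  have [x Vx] := V0 (b 0%N); exists x => n; rewrite leqn0 => /eqP->//.
have [|y yb] := IH (fun n => b n.+1); first by move=> n; exact: bA.
have [|x Vx fx] := fV (b 0%N) y.
  by exists (b 1%N); [exact: bA|exact: (yb 0%N)].
exists x => -[|n] nN //=; rewrite -iterS iterSr fx; exact: yb.
Qed.

Lemma itinerary_set_neq0 b : coupled_expanding A V f ->
  symbol_space A b -> itinerary_set f V b !=set0.
Proof.
move=> fV bA; apply/set0P/negP => /eqP b0.
have [|||N bN] := @compact_decreasing_eq0 _ (finite_itinerary_set b) cX.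
- exact: closed_finite_itinerary_set.
- by move=> n p np x xp k kn; apply: xp; exact: leq_trans np.
- by rewrite bigcap_finite_itinerary_set.
by have [x] := finite_itinerary_set_neq0 N fV bA; rewrite bN.
Qed.

(** The closed sets of points that follow [b] up to [N] and lie outside the interior of [U] decrease
    to the empty set, so one of them is already empty. *)
Lemma finite_itinerary_set_sub_nbhs b x (U : set X) :
  itinerary_set f V b = [set x] -> nbhs x U ->
  exists N, finite_itinerary_set b N `<=` U.
Proof.
move=> bx xU.
have [|||N bN] := @compact_decreasing_eq0 _
  (fun N => finite_itinerary_set b N `&` ~` U^°) cX.
- move=> N; apply: closedI; first exact: closed_finite_itinerary_set.
  exact/open_closedC/open_interior.
- move=> n p np y [yp yU]; split => // k kn; apply: yp; exact: leq_trans np.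
- rewrite -subset0 => y yb; have yx : y = x.
    suff : [set x] y by [].
    rewrite -bx -bigcap_finite_itinerary_set => n _.
    by have [] := yb n I.
  by have [_] := yb 0%N I; rewrite yx; apply.
exists N => y yN; apply: interior_subset; apply: contrapT => yU.
by suff : set0 y by []; rewrite -bN.
Qed.

End itineraries.

(** * Upper and lower limits of sequences in the unit interval *)

Section limn_sup_inf_unit_interval.
Context (R : realType) (u : R^nat).
Context (u01 : forall n, 0 <= u n <= 1).

Let bounded_u : bounded_fun u.
Proof.
exists 1; split; first exact: num_real.
move=> M M1 n _ /=; have /andP[u0 u1] := u01 n.
by rewrite ger0_norm// (le_trans u1)// ltW.
Qed.

Lemma limn_sup_eq1 :
  (forall e n, 0 < e -> exists2 k, (n <= k)%N & 1 - e <= u k) ->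
  limn_sup u = 1.
Proof.
move=> u1; rewrite limn_supE//.
suff -> : range (sups u) = [set 1] by rewrite inf1.
have sups1 n : sups u n = 1.
  apply/eqP; rewrite eq_le; apply/andP; split.
    apply: ge_sup => [|_ [k _ <-]]; first by exists (u n), n => //=.
    by have /andP[] := u01 k.
  apply/ler_addgt0Pr => e e0; rewrite -lerBlDr.
  have [k nk uk] := u1 e n e0; apply: (le_trans uk).
  apply: ub_le_sup; last by exists k.
  by exists 1 => _ [j _ <-]; have /andP[] := u01 j.
by apply/seteqP; split => [_ [n _ <-]|_ ->]; [exact: sups1|exists 0%N].
Qed.

Lemma limn_inf_eq0 :
  (forall e n, 0 < e -> exists2 k, (n <= k)%N & u k <= e) ->
  limn_inf u = 0.
Proof.
move=> u0; rewrite limn_infE//.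
suff -> : range (infs u) = [set 0] by rewrite sup1.
have infs0 n : infs u n = 0.
  apply/eqP; rewrite eq_le; apply/andP; split.
    apply/ler_addgt0Pr => e e0; rewrite add0r.
    have [k nk uk] := u0 e n e0; apply: le_trans uk.
    apply: ge_inf; last by exists k.
    by exists 0 => _ [j _ <-]; have /andP[] := u01 j.
  apply: lb_le_inf => [|_ [k _ <-]]; first by exists (u n), n => //=.
  by have /andP[] := u01 k.
by apply/seteqP; split => [_ [n _ <-]|_ ->]; [exact: infs0|exists 0%N].
Qed.

End limn_sup_inf_unit_interval.

(** * Counting exceptional times in factorial windows *)

(** Only the first [a] and the last [c] indices can satisfy [P], so its indicator is at most the sum
    of theirs. *)
Lemma card_ord_pred_le (P : pred nat) (a c n : nat) :
  (forall i, (a <= i)%N -> (i + c < n)%N -> ~~ P i) ->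
  (#|[pred i : 'I_n | P i]| <= a + c)%N.
Proof.
move=> nP; rewrite -sum1_card big_mkcond /=.
apply: (@leq_trans (\sum_(i < n) ((i < a) + (n - c <= i)))%N).
  apply: leq_sum => i _; rewrite inE; case: ifP => // Pi.
  have := nP i; have := ltn_ord i; rewrite Pi.
  case: (ltnP i a) => //= ai iN /(_ isT); case: (leqP (n - c) i) => //= ic.
  by move=> H; have : false by apply: H; rewrite addnC -ltn_subRL.
rewrite big_split leq_add//.
  suff /leq_trans : (\sum_(i < n) (i < a) <= minn a n)%N.
    by apply; exact: geq_minl.
  elim: n {nP} => [|n]; first by rewrite big_ord0.
  rewrite big_ord_recr /=; set s := (\sum_(i < n) _)%N => IH.
  by case: (ltnP n a) => ? /=; lia.
suff H k : (\sum_(i < k) (n - c <= i) <= k - (n - c))%N.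
  by apply: leq_trans (H n) _; lia.
elim: k => [|k]; first by rewrite big_ord0.
rewrite big_ord_recr /=; set s := (\sum_(i < k) _)%N => IH.
by case: (leqP (n - c) k) => ? /=; lia.
Qed.

(** At most L k! + C <= (C + 1) L k! indices satisfy [P], a proportion of at most (C + 1) / (k + 1),
    which tends to 0 for fixed [C]. *)
Lemma card_factorial_window_le (P : pred nat) (L C k : nat) : (0 < L)%N ->
  (forall i, (L * k`! <= i)%N -> (i + C < L * k.+1`!)%N -> ~~ P i) ->
  (#|[pred i : 'I_(L * k.+1`!) | P i]| * k.+1 <= C.+1 * (L * k.+1`!))%N.
Proof.
move=> L0 /card_ord_pred_le cardP.
have Lk : (0 < L * k`!)%N by rewrite muln_gt0 L0 fact_gt0.
rewrite [in leqRHS]factS (mulnC k.+1 k`!) 2![in leqRHS]mulnA leq_mul2r /=.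
by rewrite (leq_trans cardP)// -mulnA mulSn leq_add2l
  -[leqLHS]muln1 leq_mul2l Lk orbT.
Qed.

(** * Distribution functions from windows of times *)

Section distribution_functions.
Context (R : realType) (X : metricType R) (f : X -> X) (x y : X) (L C : nat).
Context (L0 : (0 < L)%N).

Lemma dist_fun_itv t n : 0 <= dist_fun f x y n t <= 1.
Proof.
rewrite /dist_fun divr_ge0//=; have [->|n0] := posnP n.
  by rewrite invr0 mulr0.
rewrite ler_pdivrMr ?ltr0n// mul1r ler_nat.
by rewrite (leq_trans (max_card _))// card_ord.
Qed.

Let window_ratio (e : R) n c : 0 < e ->
  (Num.truncn (C.+1%:R / e) <= n)%N -> (c * n.+1 <= C.+1 * (L * n.+1`!))%N ->
  c%:R / (L * n.+1`!)%:R <= e.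
Proof.
move=> e0 en cn.
have N0 : (0 < L * n.+1`!)%N by rewrite muln_gt0 L0 fact_gt0.
rewrite ler_pdivrMr ?ltr0n//.
have Ce : C.+1%:R <= e * n.+1%:R.
  rewrite mulrC -ler_pdivrMr// ltW// (lt_le_trans (truncnS_gt _))//.
  by rewrite ler_nat.
rewrite -(@ler_pM2r _ n.+1%:R) ?ltr0n// -natrM.
rewrite (@le_trans _ _ (C.+1 * (L * n.+1`!))%:R) ?ler_nat//.
by rewrite natrM mulrAC ler_wpM2r.
Qed.

Let window_ge n k : (n <= k)%N -> (n <= L * k.+1`!)%N.
Proof.
move=> nk; rewrite (leq_trans nk)// (leq_trans (leqnSn k))//.
by rewrite (leq_trans (fact_geq _))// leq_pmull.
Qed.

(** [C] leaves room for boundary effects at the end of each window; neither these times nor those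
    before the window count in the limit. *)
Lemma lower_dist_fun_eq0 s :
  (forall n, exists2 k, (n <= k)%N & forall i, (L * k`! <= i)%N ->
    (i + C < L * k.+1`!)%N -> s <= mdist (iter i f x) (iter i f y)) ->
  lower_dist_fun f x y s = 0.
Proof.
move=> far; apply: limn_inf_eq0 => [n|e n e0]; first exact: dist_fun_itv.
have [k nk kfar] := far (maxn n (Num.truncn (C.+1%:R / e))).
move: nk; rewrite geq_max => /andP[nk ek].
exists (L * k.+1`!)%N; first exact: window_ge.
apply: window_ratio ek _ => //.
apply: (@card_factorial_window_le
  (fun i => mdist (iter i f x) (iter i f y) < s)) => // i Li iL.
by rewrite -leNgt kfar.
Qed.

Lemma upper_dist_fun_eq1 t :
  (forall n, exists2 k, (n <= k)%N & forall i, (L * k`! <= i)%N ->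
    (i + C < L * k.+1`!)%N -> mdist (iter i f x) (iter i f y) < t) ->
  upper_dist_fun f x y t = 1.
Proof.
move=> close; apply: limn_sup_eq1 => [n|e n e0]; first exact: dist_fun_itv.
have [k nk kclose] := close (maxn n (Num.truncn (C.+1%:R / e))).
move: nk; rewrite geq_max => /andP[nk ek].
exists (L * k.+1`!)%N; first exact: window_ge.
(* The same count, applied to the times that are not close. *)
have := @card_factorial_window_le
  (fun i => ~~ (mdist (iter i f x) (iter i f y) < t)) L C k L0.
move=> /(_ _)/(window_ratio e0 ek) far.
rewrite lerBlDr -lerBlDl; apply: le_trans (far _); last first.
  by move=> i Li iL; rewrite negbK kclose.
have N0 : (L * k.+1`!)%:R != 0 :> R.
  by rewrite pnatr_eq0 -lt0n muln_gt0 L0 fact_gt0.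
rewrite /dist_fun -{1}(divff N0) -mulrBl ler_wpM2r// lerBlDl -natrD ler_nat.
rewrite -[X in (X <= _)%N](card_ord) -(cardC [pred i : 'I_(L * k.+1`!) |
  mdist (iter i f x) (iter i f y) < t]).
by rewrite leq_add2l; apply: subset_leq_card; apply/fintype.subsetP.
Qed.

End distribution_functions.

(** * Loops in the transition graph *)

Section loops.
Context (m : nat) (A : 'M[nat]_m).
Context (A_trans : transition_matrix A) (A_irr : irreducible_matrix A).

Definition admissible : rel 'I_m := [rel i j | A i j == 1%N].

Lemma admissible_gt0 i j : admissible i j = (0 < A i j)%N.
Proof.
have [/(_ i j) A01 _ _] := A_trans.
by rewrite /admissible /=; case: A01 => ->.
Qed.

(** A positive entry of [A * A ^+ k] has a positive summand, which yields the first edge of the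
    path. *)
Lemma expmx_gt0_path k i j : (0 < (A ^+ k) i j)%N ->
  exists2 p, path admissible i p & last i p = j.
Proof.
elim: k i => [|k IH] i.
  by rewrite expr0 mxE; case: eqVneq => // <- _; exists [::].
rewrite exprS mxE lt0n sum_nat_eq0 negb_forall => /existsP[l].
rewrite negb_imply /= -lt0n muln_gt0 => /andP[il /IH[p lp <-]].
by exists (l :: p) => //; rewrite [path _ _ _]/= lp andbT admissible_gt0.
Qed.

Lemma irreducible_path i j : exists2 p, path admissible i p & last i p = j.
Proof. by have [k _ /expmx_gt0_path] := A_irr i j. Qed.

Lemma row_branch (i : 'I_m) : (2 <= \sum_(j < m) A i j)%N ->
  exists j1 j2, [/\ j1 != j2, admissible i j1 & admissible i j2].
Proof.
move=> sum2; apply: contrapT => nobranch; move: sum2.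
have [j1 Aij1|A0] := pickP (admissible i); last first.
  rewrite big1 // => j _; apply/eqP.
  by have := A0 j; rewrite admissible_gt0; case: (A i j).
rewrite (bigD1 j1)//= big1 => [|j jj1].
  by have /eqP-> := Aij1.
apply/eqP; rewrite -leqn0 leqNgt -admissible_gt0; apply/negP => Aij.
by apply: nobranch; exists j1, j; rewrite eq_sym.
Qed.

(* Two loops which branch off after the same initial path need not have the same
   length, so they are concatenated in both orders. *)
Lemma branching_loops (a i0 : 'I_m) : (2 <= \sum_(j < m) A i0 j)%N ->
  exists p q, [/\ path admissible a p, path admissible a q,
    last a p = a, last a q = a & size p = size q /\ p != q].
Proof.
move=> /row_branch[j1 [j2 [j12 ij1 ij2]]].
have [p ap pi] := irreducible_path a i0.
have [q1 jq1 q1a] := irreducible_path j1 a.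
have [q2 jq2 q2a] := irreducible_path j2 a.
have loop j q : admissible i0 j -> path admissible j q -> last j q = a ->
    path admissible a (p ++ j :: q) /\ last a (p ++ j :: q) = a.
  move=> ij jq qa; split; last by rewrite last_cat pi.
  by rewrite cat_path ap pi [path _ _ _]/= jq andbT.
have [l1 l1a] := loop _ _ ij1 jq1 q1a.
have [l2 l2a] := loop _ _ ij2 jq2 q2a.
exists ((p ++ j1 :: q1) ++ (p ++ j2 :: q2)).
exists ((p ++ j2 :: q2) ++ (p ++ j1 :: q1)).
split; first by rewrite cat_path l1 l1a l2.
- by rewrite cat_path l2 l2a l1.
- by rewrite last_cat l1a l2a.
- by rewrite last_cat l2a l1a.
split; first by rewrite size_cat [RHS]size_cat addnC.
by rewrite -!catA eqseq_cat// eqxx /= eqseq_cons (negbTE j12).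
Qed.

Lemma path_flatten_nseq (a : 'I_m) p T : path admissible a p -> last a p = a ->
  path admissible a (flatten (nseq T p)) /\ last a (flatten (nseq T p)) = a.
Proof.
move=> ap pa; elim: T => //= T [IHp IHl].
by rewrite cat_path last_cat ap pa.
Qed.

Lemma loop_off_periodic (alpha : nat -> 'I_m) (T : nat) :
  (exists i0 : 'I_m, (2 <= \sum_(j < m) A i0 j)%N) -> (0 < T)%N ->
  (forall n, alpha (n + T)%N = alpha n) ->
  exists L (v : nat -> 'I_m),
    [/\ (0 < L)%N, forall n, alpha (n + L)%N = alpha n,
        v 0%N = alpha 0%N /\ v L = alpha 0%N,
        forall i, (i < L)%N -> A (v i) (v i.+1) = 1%N &
        exists2 r, (r < L)%N & v r != alpha r].
Proof.
move=> [i0 i0A] T0 alphaT; set a := alpha 0%N.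
have [p [q [ap aq pa qa [spq pq]]]] := branching_loops a i0A.
(* The factor [T] makes [L] a period of [alpha]; [T] copies of either loop have length [L]. *)
pose L := (T * size p)%N.
have sizeL (w : seq 'I_m) : size w = size p -> size (flatten (nseq T w)) = L.
  by move=> sw; rewrite size_flatten /shape map_nseq sumn_nseq sw mulnC.
have alphaL n : alpha (n + L)%N = alpha n.
  rewrite /L mulnC; elim: (size p) => [|k IH]; first by rewrite addn0.
  by rewrite mulSnr addnA alphaT.
have p0 : (0 < size p)%N.
  rewrite lt0n; apply: contraNneq pq => p0.
  by move: spq; rewrite p0 => /esym/size0nil->; rewrite -size_eq0 p0.
suff [w [sw aw wa [r rL wr]]] : exists w, [/\ size w = size p,
    path admissible a w, last a w = a &
    exists2 r, (r < L)%N & nth a (a :: flatten (nseq T w)) r != alpha r].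
  have [aTw lTw] := path_flatten_nseq T aw wa.
  exists L, (nth a (a :: flatten (nseq T w))); split => //.
  - by rewrite muln_gt0 T0.
  - split => //; rewrite -(sizeL w sw).
    by have := nth_last a (a :: flatten (nseq T w)) => /= ->.
  - move=> i iL; apply/eqP.
    by move/(pathP a): aTw => /(_ i); rewrite sizeL//; apply.
  - by exists r.
(* Otherwise the [T]-fold repetitions of [p] and [q] both follow [alpha], hence coincide, and
   [p = q]. *)
apply: contrapT => agree.
have alphaE w : size w = size p -> path admissible a w -> last a w = a ->
    forall i, (i < L)%N -> nth a (flatten (nseq T w)) i = alpha i.+1.
  (* Index [L] is not covered by [agree], but there the loop has returned to [a], which is also the
     value of [alpha] at [L]. *)
  move=> sw aw wa i; rewrite leq_eqVlt => /predU1P[iL|iL].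
    have [_ lTw] := path_flatten_nseq T aw wa.
    rewrite -nth_last sizeL// -iL /= in lTw.
    by rewrite lTw iL; exact/esym/(alphaL 0%N).
  apply/eqP; apply: contrapT => /negP wi; apply: agree.
  by exists w; split => //; exists i.+1.
have /eqP : flatten (nseq T p) = flatten (nseq T q).
  apply: (@eq_from_nth _ a); first by rewrite !sizeL.
  by move=> i; rewrite sizeL// => iL; rewrite !alphaE.
by case: T T0 {alphaT L sizeL alphaL agree alphaE} => //= T _;
  rewrite eqseq_cat// (negbTE pq).
Qed.

(** * Itineraries assembled from blocks *)

Definition block_code (L : nat) (u v : nat -> 'I_m) (g : nat -> bool) :
    nat -> 'I_m :=
  fun i => (if g (i %/ L)%N then v else u) (i %% L)%N.

Lemma block_codeE L u v g q r : (r < L)%N ->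
  block_code L u v g (q * L + r)%N = (if g q then v else u) r.
Proof.
move=> rL; rewrite /block_code divnMDl; last exact: leq_ltn_trans rL.
by rewrite divn_small// addn0 modnMDl modn_small.
Qed.

(** Every block starts at [a], the value of both words at [L], so the passage to the next block is
    the last transition of the current word. *)
Lemma symbol_space_block_code L u v g a : (0 < L)%N ->
  u 0%N = a -> u L = a -> v 0%N = a -> v L = a ->
  (forall i, (i < L)%N -> A (u i) (u i.+1) = 1%N) ->
  (forall i, (i < L)%N -> A (v i) (v i.+1) = 1%N) ->
  symbol_space A (block_code L u v g).
Proof.
move=> L0 u0 uL v0 vL uA vA i.
pose w q := if g q then v else u.
have w0 q : w q 0%N = a by rewrite /w; case: (g q).
have wL q : w q L = a by rewrite /w; case: (g q).
have wA q r : (r < L)%N -> A (w q r) (w q r.+1) = 1%N.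
  by rewrite /w; case: (g q); [exact: vA|exact: uA].
rewrite (divn_eq i L); set q := (i %/ L)%N; set r := (i %% L)%N.
have rL : (r < L)%N by rewrite ltn_mod.
rewrite -addnS block_codeE//.
have := rL; rewrite leq_eqVlt => /predU1P[rL'|rL']; last first.
  by rewrite block_codeE//; exact: wA.
rewrite rL' -mulSnr -[X in block_code _ _ _ _ X]addn0 block_codeE//.
by have := wA q r rL; rewrite -/(w q) -/(w q.+1) rL' wL w0.
Qed.

End loops.

(** * Bits indexed by windows *)

(** The bound on [k] loses nothing, since k <= k! <= n in window [k]; 0 lies in no window and gets
    [false]. *)
Definition window_code (h : pred nat) (n : nat) : bool :=
  [exists k : 'I_n.+1, (k`! <= n < k.+1`!)%N && h k].

Lemma window_codeE (h : pred nat) k n :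
  (k`! <= n < k.+1`!)%N -> window_code h n = h k.
Proof.
move=> /andP[kn nk].
have leq_window i j : (i`! <= n)%N -> (n < j.+1`!)%N -> (i <= j)%N.
  move=> i_n nj; rewrite leqNgt; apply/negP => /leq_fact ji.
  by have := leq_trans nj (leq_trans ji i_n); rewrite ltnn.
have k_n : (k < n.+1)%N by rewrite ltnS (leq_trans _ kn)// fact_geq.
apply/existsP/idP => [[j /andP[/andP[jn nj] hj]]|hk]; last first.
  by exists (Ordinal k_n); rewrite /= kn nk hk.
suff -> : k = j :> nat by [].
by apply/eqP; rewrite eqn_leq; apply/andP; split; exact: leq_window.
Qed.

(* The digit [c n] is repeated along the infinitely many [k] with
   [logn 2 k = n.+1], and the odd [k] carry [false] for every [c]. *)
Definition spread (c : nat -> bool) (k : nat) : bool :=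
  (0 < logn 2 k)%N && c (logn 2 k).-1.

Lemma frequently_logn2 n N : exists2 k, (N <= k)%N & logn 2 k = n.
Proof.
exists (2 ^ n * N.*2.+1)%N.
  by rewrite (@leq_trans N.*2.+1)// ?leq_pmull ?expn_gt0// -addnn; lia.
by rewrite lognM ?expn_gt0// pfactorK// lognE /= dvdn2 /= odd_double /= addn0.
Qed.

(** Cantor's diagonal argument: [D] disagrees with each [c] at the index [g (F c)], hence with
    itself. *)
Lemma uncountable_range_bool_seq (T : Type) (F : (nat -> bool) -> T) :
  injective F -> ~ countable (range F).
Proof.
move=> injF /countable_injP[g /= gi].
pose D n := `[<exists2 c, g (F c) = n & ~~ c n>].
have [Dn|Dn] := boolP (D (g (F D))).
  move: (Dn) => /asboolP[c gc]; suff -> : c = D by rewrite Dn.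
  by apply: injF; apply: gi => //; rewrite inE; eexists.
by move: (Dn) => /asboolP; apply; exists D.
Qed.

(** * Distances between orbits of coded points *)

Section coded_points.
Context (R : realType) (X : metricType R) (m : nat) (f : X -> X)
  (V : 'I_m -> set X).
Context (cX : compact [set: X]) (fc : continuous f)
  (cV : forall i, compact (V i)).

Lemma disjoint_compacts_dist :
  (forall i j, i != j -> 0 < set_dist (V i) (V j)) ->
  exists2 d : R, 0 < d &
    forall i j x y, i != j -> V i x -> V j y -> d <= mdist x y.
Proof.
(* Starting the minimum at 1 keeps it positive even if there is no pair. *)
move=> V0; pose d := \big[Num.min/1]_(p : 'I_m * 'I_m | p.1 != p.2)
  set_dist (V p.1) (V p.2).
exists d.
  rewrite /d; elim/big_ind: _ => // [a b a0 b0|p /V0//].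
  by rewrite lt_min a0.
move=> i j x y ij Vx Vy.
apply: (@le_trans _ _ (set_dist (V i) (V j))).
  by rewrite /d (bigD1 (i, j))//= ge_min lexx.
apply: ge_inf; last by exists x => //; exists y.
by exists 0 => _ [? _ [? _ ->]]; exact: mdist_ge0.
Qed.

Context (alpha v : nat -> 'I_m) (L : nat) (x0 : X) (d : R).
Context (L0 : (0 < L)%N) (alphaL : forall n, alpha (n + L)%N = alpha n)
  (alphax0 : itinerary_set f V alpha = [set x0])
  (Vd : forall i j x y, i != j -> V i x -> V j y -> d <= mdist x y).

Let code h := block_code L alpha v (window_code h).

Let alpha_mod n q : alpha (q * L + n)%N = alpha n.
Proof.
by elim: q => [|q IH]; rewrite ?mul0n ?add0n// mulSn -addnA addnC alphaL.
Qed.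

(** The ends of the window are multiples of [L], so going back to the start of the current block
    does not leave it. *)
Let div_window i C k : (L * k`! <= i)%N -> (i + C < L * k.+1`!)%N ->
  forall j, (i %/ L * L <= j <= i + C)%N -> (k`! <= j %/ L < k.+1`!)%N.
Proof.
move=> ki iC j /andP[ij jC]; rewrite leq_divRL// ltn_divLR//.
apply/andP; split; last by rewrite mulnC (leq_ltn_trans jC).
by apply: leq_trans ij; rewrite leq_mul2r leq_divRL// mulnC ki orbT.
Qed.

Let code_alpha h k n : h k = false -> (k`! <= n %/ L < k.+1`!)%N ->
  code h n = alpha n.
Proof.
move=> hk nk; rewrite /code /block_code (window_codeE _ nk) hk.
by rewrite {2}(divn_eq n L) alpha_mod.
Qed.

Lemma codes_agree_upper_dist_fun h h' x y t :
  itinerary_set f V (code h) x -> itinerary_set f V (code h') y ->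
  (forall n, exists2 k, (n <= k)%N & h k = false /\ h' k = false) ->
  0 < t -> upper_dist_fun f x y t = 1.
Proof.
move=> hx h'y hh' t0.
(* One neighbourhood of [x0] controls the iterates below [L], enough for any position inside a
   block. *)
have [N NU] : exists N, finite_itinerary_set f V alpha N `<=`
    [set z | forall p : 'I_L, mdist (iter p f x0) (iter p f z) < t / 2].
  apply: (finite_itinerary_set_sub_nbhs cX fc cV alphax0).
  apply: filter_forall => p; apply: continuous_mdist_near.
    exact: continuous_iter.
  by rewrite divr_gt0.
apply: (@upper_dist_fun_eq1 _ _ _ _ _ L (L + N)) => // n.
have [k nk [hk h'k]] := hh' n; exists k => // i ki iC.
pose q := (i %/ L)%N; pose p := Ordinal (ltn_pmod i L0).
have iE : i = (p + q * L)%N by rewrite addnC /= -divn_eq.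
(* At the start of a block [alpha] has phase 0, so [iter (q * L) f z] follows [alpha] for [N] steps
   and is near [x0]; [p] more steps lead to time [i]. *)
have close g z : g k = false -> itinerary_set f V (code g) z ->
    mdist (iter p f x0) (iter i f z) < t / 2.
  move=> gk gz; rewrite [in iter i]iE iterD; apply: NU => j jN.
  have := gz (j + q * L)%N I; rewrite /= iterD (code_alpha gk); last first.
    apply: (div_window ki iC); rewrite -/q leq_addl /= [X in (_ <= X + _)%N]iE.
    by have := ltn_ord p; lia.
  by rewrite addnC alpha_mod.
rewrite (le_lt_trans (metric_triangle _ (iter p f x0) _))// (splitr t) ltrD//.
  by rewrite metric_sym; exact: close hk hx.
exact: close h'k h'y.
Qed.

(** At this time one point is in [V (v r)] and the other in [V (alpha r)]. *)
Lemma codes_differ_mdist h h' x y r k q :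
  (r < L)%N -> v r != alpha r -> (k`! <= q < k.+1`!)%N -> h k != h' k ->
  itinerary_set f V (code h) x -> itinerary_set f V (code h') y ->
  d <= mdist (iter (q * L + r) f x) (iter (q * L + r) f y).
Proof.
move=> rL vr qk hk hx h'y; apply: Vd (hx _ I) (h'y _ I).
rewrite /code !block_codeE// !(window_codeE _ qk).
by case: (h k) (h' k) hk => -[] // _; rewrite // eq_sym.
Qed.

Lemma codes_differ_lower_dist_fun h h' x y s r :
  (forall i z w, (i <= 2 * L)%N -> mdist z w < s ->
    mdist (iter i f z) (iter i f w) < d) ->
  (r < L)%N -> v r != alpha r ->
  itinerary_set f V (code h) x -> itinerary_set f V (code h') y ->
  (forall n, exists2 k, (n <= k)%N & h k != h' k) ->
  lower_dist_fun f x y s = 0.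
Proof.
move=> sd rL vr hx h'y hh'.
apply: (@lower_dist_fun_eq0 _ _ _ _ _ L (2 * L)) => // n.
have [k nk hk] := hh' n; exists k => // i ki iC.
rewrite leNgt; apply/negP.
(* Position [r] of the next block comes after [i], at most [2 * L] steps later; orbits that are
   [s]-close at [i] would be [d]-close there. *)
pose q := (i %/ L).+1; pose j := (q * L + r - i)%N.
have jL : (j <= 2 * L)%N.
  by rewrite /j /q mulSn {2}(divn_eq i L); lia.
have ijE : (j + i = q * L + r)%N.
  rewrite subnK// /q mulSn {1}(divn_eq i L) (leq_trans _ (leq_addr _ _))//.
  by rewrite addnC leq_add2r ltnW// ltn_mod.
move=> /(sd j _ _ jL); apply/negP; rewrite -leNgt -!iterD ijE.
apply: (codes_differ_mdist rL vr _ hk hx h'y).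
have -> : q = ((j + i) %/ L)%N by rewrite ijE divnMDl// divn_small// addn0.
  apply: (div_window ki iC).
by rewrite (leq_trans (leq_trunc_div i L)) ?leq_addl//= addnC leq_add2l.
Qed.

End coded_points.

Theorem theorem3p2 (R : realType) (X : metricType R) (m : nat)
    (f : X -> X) (A : 'M[nat]_m) (V : 'I_m -> set X)
    (X_compact : compact [set: X])
    (m_ge2 : (2 <= m)%N)
    (f_cont : continuous f)
    (A_trans : transition_matrix A)
    (A_irr : irreducible_matrix A)
    (A_row : exists i0 : 'I_m, (2 <= \sum_(j < m) A i0 j)%N)
    (V_compact : forall i : 'I_m, compact (V i))
    (f_exp : strictly_coupled_expanding A V f)
    (V_alpha : exists alpha : nat -> 'I_m,
       [/\ symbol_space A alpha,
           exists2 T : nat, (1 <= T)%N & iter T (@seq_shift 'I_m) alpha = alpha &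
           exists x : X, itinerary_set f V alpha = [set x]]) :
  dist_chaotic1 f.
Proof.
have [alpha [alphaA [T T1 alphaT] [x0 alphax0]]] := V_alpha.
have [fV /disjoint_compacts_dist[d d0 Vd]] := f_exp.
have alphaP n : alpha (n + T)%N = alpha n.
  rewrite -[in RHS]alphaT; elim: T n {T1 alphaT} => [|T IH] n /=.
    by rewrite addn0.
  by rewrite /seq_shift addnS -addSn IH.
have [L [v [L0 alphaL [v0 vL] vA [r rL vr]]]] :=
  loop_off_periodic A_trans A_irr A_row T1 alphaP.
(* Uniform continuity of finitely many iterates, with a common [s]. *)
have [s s0 sd] : exists2 s : R, 0 < s & forall i z w, (i <= 2 * L)%N ->
    mdist z w < s -> mdist (iter i f z) (iter i f w) < d.
  have : \forall s \near (0 : R)^'+, forall i : 'I_(2 * L).+1, forall z w,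
      mdist z w < s -> mdist (iter i f z) (iter i f w) < d.
    apply: filter_forall => i; apply: compact_uniform_mdist => //.
    exact: continuous_iter.
  move=> /(filterI (nbhs_right_gt 0))/filter_ex[s [s0 sP]].
  by exists s => // i z w iL; exact: (sP (Ordinal (iL : (i < (2 * L).+1)%N))).
pose code c := block_code L alpha v (window_code (spread c)).
have [F FP] : {F & forall c, itinerary_set f V (code c) (F c)}.
  apply: (@choice _ _ (fun c => itinerary_set f V (code c))) => c.
  apply: (itinerary_set_neq0 X_compact f_cont V_compact fV).
  apply: symbol_space_block_code L0 (erefl _) _ v0 vL _ vA => //.
  by have := alphaL 0%N.
have spread_neq c c' N : c <> c' ->
    exists2 k, (N <= k)%N & spread c k != spread c' k.
  move=> cc'; have [n cn] : exists n, c n != c' n.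
    apply: contrapT => /forallNP cE; apply: cc'; apply/funext => n.
    by have /negP := cE n; rewrite negbK => /eqP.
  have [k Nk kn] := frequently_logn2 n.+1 N.
  by exists k => //; rewrite /spread kn.
have injF : injective F.
  (* Window 0 is empty since 0! = 1!, so a window with index at least 1 is chosen; its first block
     separates the points. *)
  move=> c c' cc'; apply: contrapT => /(spread_neq _ _ 1%N)[k k0 ck].
  have := FP c'; rewrite -cc' => Fc'.
  have kk : (k`! <= k`! < k.+1`!)%N.
    by rewrite leqnn factS -[ltnLHS]mul1n ltn_pmul2r ?fact_gt0.
  have := codes_differ_mdist Vd rL vr kk ck (FP c) Fc'.
  by rewrite mdistxx leNgt d0.
exists (range F); first exact: uncountable_range_bool_seq.
split.
  exists (F xpredT), (F xpred0); split; [by exists xpredT|by exists xpred0|].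
  by move=> /injF/(congr1 (@^~ 0%N)).
move=> _ _ [c _ <-] [c' _ <-] cc'; split.
  move=> t t0.
  apply: (codes_agree_upper_dist_fun X_compact f_cont V_compact L0 alphaL
    alphax0 (FP c) (FP c')) => // N.
  (* Odd windows carry [false] for both sequences. *)
  by have [k Nk k0] := frequently_logn2 0 N; exists k; rewrite // /spread k0.
exists s => //.
apply: (codes_differ_lower_dist_fun L0 Vd sd rL vr (FP c) (FP c')) => N.
by apply: spread_neq => cE; apply: cc'; rewrite cE.
Qed.
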